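(* If the set $\mathcal{L}(p)=\Big\{y\in\partial\Omega:\dfrac{y-p}{|y-p|}\cdot\nu_y=1\Big\}$ consists of a single point, then $\mathcal{M}_2^+(p)\cup\mathcal{M}_2^-(p)\cup\mathcal{M}_g(p)=\emptyset$.
   Context: Setting. $\Omega\subset\mathbb{R}^3$ is a bounded domain with $C^{2,\alpha_0}$ boundary, $0<\alpha_0\le 1$; $D$ is an open subset of $\Omega$ with $C^{2,\alpha_0}$ boundary such that $\overline D\subset\Omega$ and $\Omega\setminus\overline D$ is connected; $p\in\mathbb{R}^3\setminus\overline\Omega$. $\nu_x$ ($x\in\partial D$) and $\nu_y$ ($y\in\partial\Omega$) are the unit outward normals of $D$ and $\Omega$. $l_p(x,y)=|p-x|+|x-y|$, $l(p,D)=\inf_{(x,y)\in\partial D\times\partial\Omega}l_p(x,y)$, $\mathcal{M}(p)=\{(x,y)\in\partial D\times\partial\Omega:l_p(x,y)=l(p,D)\}$. For $z$ outside $D$, $\mathcal{G}(z)=\{x\in\partial D:\nu_x\cdot(z-x)=0\}$ and $\mathcal{G}^{\pm}(z)=\{x\in\partial D:\pm\nu_x\cdot(z-x)>0\}$. $\mathcal{M}_2^{\pm}(p)=\{(x,y)\in\mathcal{M}(p):x\in\mathcal{G}^{\pm}(p)\cap\mathcal{G}^{\mp}(y)\}$ and $\mathcal{M}_g(p)=\{(x,y)\in\mathcal{M}(p):x\in\mathcal{G}(p)\}$. *)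

(* Defs.v *)
From HB Require Import structures.
From mathcomp Require Import all_boot all_order all_algebra.
From mathcomp Require Import all_classical all_reals all_analysis.

Set Implicit Arguments.
Unset Strict Implicit.
Unset Printing Implicit Defensive.

Import Order.TTheory GRing.Theory Num.Theory.
Import numFieldNormedType.Exports.

Local Open Scope classical_set_scope.
Local Open Scope ring_scope.

(* The library norm `|x| on row vectors is the sup norm; the Euclidean norm
   is enorm.  The two induce the same topology and the same bounded sets, so
   open, closure, connected, bounded_set, ... are the library's. *)
Definition edot {R : realType} {n : nat} (u v : 'rV[R]_n) : R :=
  \sum_(i < n) u 0 i * v 0 i.

Definition enorm {R : realType} {n : nat} (u : 'rV[R]_n) : R :=
  Num.sqrt (edot u u).

Definition eball {R : realType} {n : nat} (c : 'rV[R]_n) (r : R) :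
    set 'rV[R]_n :=
  [set x | enorm (x - c) < r].

Definition boundary {T : topologicalType} (A : set T) : set T :=
  closure A `\` interior A.

Definition partial {R : realType} (i : 'I_2) (f : 'rV[R]_2 -> R) :
    'rV[R]_2 -> R :=
  fun x => 'D_(delta_mx 0 i) f x.

Definition C1_on {R : realType} (U : set 'rV[R]_2) (f : 'rV[R]_2 -> R) : Prop :=
  forall x, U x ->
    differentiable f x /\ forall i, {for x, continuous (partial i f)}.

Definition C2_on {R : realType} (U : set 'rV[R]_2) (f : 'rV[R]_2 -> R) : Prop :=
  C1_on U f /\ forall i, C1_on U (partial i f).

Definition hoelder_on {R : realType} (a : R) (U : set 'rV[R]_2)
    (f : 'rV[R]_2 -> R) : Prop :=
  exists C : R, forall x y, U x -> U y ->
    `|f x - f y| <= C * enorm (x - y) `^ a.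

Definition C2a_on {R : realType} (a : R) (U : set 'rV[R]_2)
    (f : 'rV[R]_2 -> R) : Prop :=
  C2_on U f /\ forall i j, hoelder_on a U (partial j (partial i f)).

(* Near each boundary point and in suitable orthonormal coordinates x *m Q,
   A is the strict epigraph of a C^{2,a} function of the first two
   coordinates; col' ord_max drops the last coordinate. *)
Definition C2a_boundary {R : realType} (a : R) (A : set 'rV[R]_3) : Prop :=
  forall x0, boundary A x0 ->
    exists (Q : 'M[R]_3) (phi : 'rV[R]_2 -> R) (r : R),
      [/\ Q *m Q^T = 1%:M,
          0 < r,
          C2a_on a (eball (col' ord_max (x0 *m Q)) r) phi &
          forall x, eball x0 r x ->
            (A x <-> phi (col' ord_max (x *m Q)) < (x *m Q) 0 ord_max)].

(* Velocities at x of curves lying in the boundary of A. *)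
Definition tangent_vector {R : realType} (A : set 'rV[R]_3)
    (x v : 'rV[R]_3) : Prop :=
  exists c : R -> 'rV[R]_3,
    [/\ c 0 = x,
        \forall t \near (0 : R), boundary A (c t) &
        is_derive (0 : R) (1 : R) c v].

Definition is_unit_outward_normal {R : realType} (A : set 'rV[R]_3)
    (x n : 'rV[R]_3) : Prop :=
  [/\ enorm n = 1,
      forall v, tangent_vector A x v -> edot n v = 0 &
      \forall t \near (0 : R)^'+, ~ closure A (x + t *: n)].

(* The unit outward normal of A at x; the default value 0 is never taken at
   a boundary point of a set with C^{2,a} boundary. *)
Definition normal {R : realType} (A : set 'rV[R]_3) (x : 'rV[R]_3) :
    'rV[R]_3 :=
  xget 0 (is_unit_outward_normal A x).

Definition path_length {R : realType} (p x y : 'rV[R]_3) : R :=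
  enorm (p - x) + enorm (x - y).

Definition min_length {R : realType} (O D : set 'rV[R]_3) (p : 'rV[R]_3) : R :=
  inf [set path_length p xy.1 xy.2 | xy in boundary D `*` boundary O].

Definition minimizers {R : realType} (O D : set 'rV[R]_3) (p : 'rV[R]_3) :
    set ('rV[R]_3 * 'rV[R]_3) :=
  [set xy | [/\ boundary D xy.1, boundary O xy.2 &
                path_length p xy.1 xy.2 = min_length O D p]].

Definition G0 {R : realType} (D : set 'rV[R]_3) (z : 'rV[R]_3) :
    set 'rV[R]_3 :=
  [set x | boundary D x /\ edot (normal D x) (z - x) = 0].

Definition Gplus {R : realType} (D : set 'rV[R]_3) (z : 'rV[R]_3) :
    set 'rV[R]_3 :=
  [set x | boundary D x /\ edot (normal D x) (z - x) > 0].

Definition Gminus {R : realType} (D : set 'rV[R]_3) (z : 'rV[R]_3) :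
    set 'rV[R]_3 :=
  [set x | boundary D x /\ - edot (normal D x) (z - x) > 0].

Definition M2plus {R : realType} (O D : set 'rV[R]_3) (p : 'rV[R]_3) :
    set ('rV[R]_3 * 'rV[R]_3) :=
  [set xy | minimizers O D p xy /\ (Gplus D p `&` Gminus D xy.2) xy.1].

Definition M2minus {R : realType} (O D : set 'rV[R]_3) (p : 'rV[R]_3) :
    set ('rV[R]_3 * 'rV[R]_3) :=
  [set xy | minimizers O D p xy /\ (Gminus D p `&` Gplus D xy.2) xy.1].

Definition Mg {R : realType} (O D : set 'rV[R]_3) (p : 'rV[R]_3) :
    set ('rV[R]_3 * 'rV[R]_3) :=
  [set xy | minimizers O D p xy /\ G0 D p xy.1].

Definition Lset {R : realType} (O : set 'rV[R]_3) (p : 'rV[R]_3) :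
    set 'rV[R]_3 :=
  [set y | boundary O y /\
           edot ((enorm (y - p))^-1 *: (y - p)) (normal O y) = 1].

(* Main.v *)
(* If [x] is not on the segment [p, y], then [|p - z| + |z - y|], which is
   convex in [z], decreases strictly from [x] into [D] in the three cases: move
   towards [y], towards [p], or towards [p] with a small inward correction.  A
   point of [D] is never better than a minimizer, because the path through it
   crosses the boundary of [D].  Hence [x] is on the segment and the minimal
   length is [|p - y|]; since [y] is a point of the boundary of Omega nearest
   to [x], the normal at [y] points along [y - p], so [y] is the unique point
   of [L(p)].  A point of the closure of Omega farthest from [p] also belongs
   to [L(p)], so it is [y].  The ray from [p] through any boundary point of [D]
   leaves Omega at a distance at least the minimal length [|p - y|], hence at
   [y]: the boundary of [D], and then [D] itself, lies on one line, although
   [D] is open and nonempty. *)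
Require Import Defs.
From HB Require Import structures.
From mathcomp Require Import all_boot all_order all_algebra.
From mathcomp Require Import all_classical all_reals all_analysis.
From mathcomp Require Import ring lra.
Import Order.TTheory GRing.Theory Num.Theory.
Import numFieldNormedType.Exports.
Local Open Scope classical_set_scope.
Local Open Scope ring_scope.

(** * Euclidean norm *)

Lemma edotC {R : realType} {n : nat} (u v : 'rV[R]_n) : edot u v = edot v u.
Proof. by apply: eq_bigr => i _; rewrite mulrC. Qed.

Lemma edotDl {R : realType} {n : nat} (u v w : 'rV[R]_n) :
  edot (u + v) w = edot u w + edot v w.
Proof. by rewrite -big_split; apply: eq_bigr => i _; rewrite mxE mulrDl. Qed.

Lemma edotZl {R : realType} {n : nat} (a : R) (u w : 'rV[R]_n) :
  edot (a *: u) w = a * edot u w.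
Proof. by rewrite mulr_sumr; apply: eq_bigr => i _; rewrite mxE mulrA. Qed.

Lemma edotNl {R : realType} {n : nat} (u w : 'rV[R]_n) :
  edot (- u) w = - edot u w.
Proof. by rewrite -scaleN1r edotZl mulN1r. Qed.

Lemma edotDr {R : realType} {n : nat} (u v w : 'rV[R]_n) :
  edot w (u + v) = edot w u + edot w v.
Proof. by rewrite edotC edotDl !(edotC w). Qed.

Lemma edotZr {R : realType} {n : nat} (a : R) (u w : 'rV[R]_n) :
  edot w (a *: u) = a * edot w u.
Proof. by rewrite edotC edotZl edotC. Qed.

Lemma edotNr {R : realType} {n : nat} (u w : 'rV[R]_n) :
  edot w (- u) = - edot w u.
Proof. by rewrite edotC edotNl edotC. Qed.

Definition edotE := (@edotDl, @edotDr, @edotNl, @edotNr, @edotZl, @edotZr).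

Lemma edot_ge0 {R : realType} {n : nat} (u : 'rV[R]_n) : 0 <= edot u u.
Proof. by apply: sumr_ge0 => i _; rewrite -expr2 sqr_ge0. Qed.

Lemma edot_eq0 {R : realType} {n : nat} (u : 'rV[R]_n) : edot u u = 0 -> u = 0.
Proof.
move=> /eqP; rewrite psumr_eq0 => [/allP u0|i _]; last first.
  by rewrite -expr2 sqr_ge0.
apply/rowP => i; rewrite mxE; apply/eqP.
by have := u0 i (mem_index_enum i); rewrite /= mulf_eq0 orbb.
Qed.

Lemma enorm_ge0 {R : realType} {n : nat} (u : 'rV[R]_n) : 0 <= enorm u.
Proof. exact: sqrtr_ge0. Qed.

Lemma sqr_enorm {R : realType} {n : nat} (u : 'rV[R]_n) :
  enorm u ^+ 2 = edot u u.
Proof. by rewrite sqr_sqrtr // edot_ge0. Qed.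

Lemma enorm0_eq0 {R : realType} {n : nat} (u : 'rV[R]_n) :
  enorm u = 0 -> u = 0.
Proof. by move=> u0; apply: edot_eq0; rewrite -sqr_enorm u0 expr0n. Qed.

Lemma enorm_gt0 {R : realType} {n : nat} (u : 'rV[R]_n) :
  u != 0 -> 0 < enorm u.
Proof.
move=> u0; rewrite lt_neqAle enorm_ge0 andbT eq_sym.
by apply: contra u0 => /eqP/enorm0_eq0 ->.
Qed.

Lemma enormZ {R : realType} {n : nat} (a : R) (u : 'rV[R]_n) :
  enorm (a *: u) = `|a| * enorm u.
Proof.
by rewrite /enorm edotE edotE mulrA -expr2 sqrtrM ?sqr_ge0 // sqrtr_sqr.
Qed.

Lemma enorm0 {R : realType} {n : nat} : enorm (0 : 'rV[R]_n) = 0.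
Proof. by rewrite -(scale0r 0) enormZ normr0 mul0r. Qed.

Lemma enormN {R : realType} {n : nat} (u : 'rV[R]_n) : enorm (- u) = enorm u.
Proof. by rewrite /enorm !edotE opprK. Qed.

Lemma enorm_distC {R : realType} {n : nat} (u v : 'rV[R]_n) :
  enorm (u - v) = enorm (v - u).
Proof. by rewrite -enormN opprB. Qed.

(* [| |v| u - |u| v |^2 = 2 |u| |v| (|u| |v| - u.v)] *)
Lemma sqr_enorm_cross {R : realType} {n : nat} (u v : 'rV[R]_n) :
  enorm (enorm v *: u - enorm u *: v) ^+ 2 =
  2 * (enorm u * enorm v) * (enorm u * enorm v - edot u v).
Proof. by rewrite sqr_enorm !edotE -!sqr_enorm (edotC v u); ring. Qed.

(** Cauchy-Schwarz, read off [sqr_enorm_cross]: its left side is a square, and the factor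
    [2 |u| |v|] can be cancelled unless one vector is zero. *)
Lemma edot_le_enorm {R : realType} {n : nat} (u v : 'rV[R]_n) :
  edot u v <= enorm u * enorm v.
Proof.
have [uv0|] := eqVneq (enorm u * enorm v) 0.
  rewrite uv0; move/eqP: uv0; rewrite mulf_eq0 => /orP[|] /eqP/enorm0_eq0 ->.
    by rewrite -(scale0r 0) edotE mul0r.
  by rewrite -(scale0r 0) edotE mul0r.
move=> uv0; have uv_gt0 : 0 < enorm u * enorm v.
  by rewrite lt_neqAle eq_sym uv0 mulr_ge0 ?enorm_ge0.
have := sqr_ge0 (enorm (enorm v *: u - enorm u *: v)).
by rewrite sqr_enorm_cross pmulr_rge0 ?subr_ge0 // mulr_gt0.
Qed.

Lemma sqr_enormD {R : realType} {n : nat} (u v : 'rV[R]_n) :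
  enorm (u + v) ^+ 2 = enorm u ^+ 2 + 2 * edot u v + enorm v ^+ 2.
Proof. by rewrite !sqr_enorm !edotE (edotC v u); ring. Qed.

Lemma ler_enormD {R : realType} {n : nat} (u v : 'rV[R]_n) :
  enorm (u + v) <= enorm u + enorm v.
Proof.
rewrite -ler_sqr ?nnegrE ?addr_ge0 ?enorm_ge0 // sqr_enormD.
by have := edot_le_enorm u v; lra.
Qed.

Lemma ler_enorm_dist {R : realType} {n : nat} (v u w : 'rV[R]_n) :
  enorm (u - w) <= enorm (u - v) + enorm (v - w).
Proof. by rewrite -[u - w](subrKA v) ler_enormD. Qed.

(** Equality in the triangle inequality forces [u.v = |u| |v|], which kills the right side of
    [sqr_enorm_cross]. *)
Lemma enormD_colinear {R : realType} {n : nat} (u v : 'rV[R]_n) :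
  enorm (u + v) = enorm u + enorm v -> enorm v *: u = enorm u *: v.
Proof.
move=> uv; apply/subr0_eq/enorm0_eq0/eqP.
rewrite -sqrf_eq0 sqr_enorm_cross.
have := sqr_enormD u v; rewrite uv => uv2.
have -> : enorm u * enorm v - edot u v = 0 by lra.
by rewrite mulr0.
Qed.


Lemma enorm_continuous {R : realType} {n : nat} :
  continuous (@enorm R n).
Proof.
move=> x; apply: (@continuous_comp _ _ _ (fun u => edot u u) Num.sqrt).
  have -> : (fun u : 'rV[R]_n => edot u u) =
      \sum_(i < n) (fun u : 'rV[R]_n => u 0 i * u 0 i).
    by apply/funext => z; rewrite fct_sumE.
  apply: differentiable_continuous; apply: differentiable_sum => i.
  by apply: differentiableM; exact: differentiable_coord.
exact: sqrt_continuous.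
Qed.
Lemma linear_rV_differentiable {R : realType} {n : nat} {W : normedModType R}
  (f : 'rV[R]_n -> W) (x : 'rV[R]_n) : linear f -> differentiable f x.
Proof.
move=> f_lin.
pose F : {linear 'rV[R]_n -> W} :=
  HB.pack f (GRing.isLinear.Build _ _ _ _ f f_lin).
have -> : f = (\sum_(i < n) (fun z : 'rV[R]_n => z 0 i *: f (delta_mx 0 i)))
    :> ('rV[R]_n -> W).
  apply/funext => z; rewrite fct_sumE -[f]/(F : _ -> _) {1}(row_sum_delta z).
  by rewrite linear_sum; apply: eq_bigr => i _; rewrite linearZ.
apply: differentiable_sum => i.
by apply: differentiableZl; exact: differentiable_coord.
Qed.

(** * Boundary charts and the outward normal *)

Lemma enorm_dist_continuous {R : realType} {n : nat} (x : 'rV[R]_n) :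
  continuous (fun z : 'rV[R]_n => enorm (z - x)).
Proof.
move=> z.
apply: (@continuous_comp _ _ _ (fun z : 'rV[R]_n => z - x) (@enorm R n)).
  by apply: continuousB; [exact: (fun _ => id)|exact: cst_continuous].
exact: enorm_continuous.
Qed.

Lemma eball_nbhs {R : realType} {n : nat} (x : 'rV[R]_n) (r : R) :
  0 < r -> \forall z \near x, eball x r z.
Proof.
move=> r0.
have := enorm_dist_continuous x x.
move/cvgr_lt; apply; rewrite subrr.
by rewrite enorm0.
Qed.

(** * Derivatives along curves and signs near a zero *)

Lemma is_derive_comp_curve {R : realType} {n : nat} (g : 'rV[R]_n -> R)
    (c : R -> 'rV[R]_n) (w : 'rV[R]_n) :
  differentiable g (c 0) -> is_derive (0 : R) (1 : R) c w ->
  is_derive (0 : R) (1 : R) (g \o c) ('d g (c 0) w).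
Proof.
move=> dg dc.
have dc0 : differentiable c 0 by apply/derivable1_diffP; exact: ex_derive.
have dgc : differentiable (g \o c) 0 by exact: differentiable_comp.
apply: DeriveDef; first exact: diff_derivable.
have dcw : 'd c 0 1 = w by rewrite -deriveE //; exact: derive_val.
by rewrite deriveE // diff_comp //= dcw.
Qed.

(** Since [f t / t] tends to [l], the product [l * (f t / t)] tends to [l ^+ 2 > 0]; multiplying by
    [t ^+ 2] gives a form that covers both signs of [l] and of [t]. *)
Lemma is_derive_near_sign {R : realType} (f : R -> R) (l : R) :
  is_derive (0 : R) (1 : R) f l -> f 0 = 0 -> l != 0 ->
  \forall t \near (0 : R)^', 0 < l * t * f t.
Proof.
move=> [/cvg_ex[l' fl'] fl] f0 l0.
have l'l : l' = l.
  by rewrite -fl; apply/esym/cvg_lim => //; exact: norm_hausdorff.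
rewrite {}l'l in fl'.
have lfl : l * (h^-1 *: ((f \o shift 0) (h *: 1) - f 0)) @[h --> 0^'] --> l * l.
  by apply: cvgM => //; exact: cvg_cst.
have /(cvgr_gt _ lfl) : 0 < l * l.
  by rewrite lt_neqAle -expr2 sqr_ge0 eq_sym sqrf_eq0 l0.
rewrite !near_withinE.
apply: filterS => t + t0; move/(_ t0) => /=.
rewrite f0 subr0 addr0 [t *: 1]mulr1 => lt0.
have -> : l * t * f t = l * (t^-1 *: f t) * t ^+ 2.
  by rewrite /GRing.scale /=; field.
by rewrite pmulr_lgt0 // lt_neqAle sqr_ge0 eq_sym sqrf_eq0 t0.
Qed.

Lemma near_right {R : realType} (x : R) (P : R -> Prop) :
  (\forall t \near x, P t) -> \forall t \near x^'+, P t.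
Proof. exact: cvg_within. Qed.

Lemma near_right_ex {R : realType} (P : R -> Prop) :
  (\forall t \near (0 : R)^'+, P t) -> exists2 t, 0 < t & P t.
Proof.
move=> Pt; have P0 : \forall t \near (0 : R)^'+, 0 < t /\ P t.
  by apply: filterI Pt; exact: nbhs_right_gt.
have [t [t0 {}Pt]] := @filter_ex _ _ (at_right_proper_filter (0 : R)) _ P0.
by exists t.
Qed.

Lemma derive_gt0_near_right {R : realType} (f : R -> R) (l : R) :
  is_derive (0 : R) (1 : R) f l -> f 0 = 0 -> 0 < l ->
  \forall t \near (0 : R)^'+, 0 < f t.
Proof.
move=> df f0 l0; have := is_derive_near_sign _ _ df f0 (lt0r_neq0 l0).
rewrite !near_withinE; apply: filterS => t + t0; move/(_ (lt0r_neq0 t0)).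
by rewrite pmulr_rgt0 // mulr_gt0.
Qed.

Lemma is_derive_local_max {R : realType} (f : R -> R) (l : R) :
  is_derive (0 : R) (1 : R) f l -> f 0 = 0 ->
  (\forall t \near (0 : R), f t <= 0) -> l = 0.
Proof.
move=> df f0 f_le0; apply/eqP; case: ltgtP => // l0; exfalso.
  have := is_derive_near_sign _ _ df f0 (ltr0_neq0 l0); rewrite near_withinE.
  move=> fs; have : \forall t \near (0 : R)^'-, False.
    rewrite near_withinE; apply: filterS (filterI fs f_le0) => t [+ ft t0].
    move/(_ (ltr0_neq0 t0)); by rewrite pmulr_rgt0 ?nmulr_rgt0 // ltNge ft.
  by move/filter_ex => [].
have fp := derive_gt0_near_right _ _ df f0 l0.
have [t _ [ft ft_le0]] := near_right_ex _ (filterI fp (near_right _ _ f_le0)).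
by move: ft; rewrite ltNge ft_le0.
Qed.

Lemma near_curve {R : realType} {n : nat} (c : R -> 'rV[R]_n)
    (w : 'rV[R]_n) (P : 'rV[R]_n -> Prop) :
  is_derive (0 : R) (1 : R) c w -> (\forall z \near c 0, P z) ->
  \forall t \near (0 : R), P (c t).
Proof.
move=> dc; have : {for 0, continuous c}.
  by apply: differentiable_continuous; apply/derivable1_diffP; exact: ex_derive.
by move=> cc /cc.
Qed.

Lemma is_derive_scalel {R : realType} {n : nat} (s : R -> R) (l : R)
    (e : 'rV[R]_n) :
  is_derive (0 : R) (1 : R) s l ->
  is_derive (0 : R) (1 : R) (fun t => s t *: e) (l *: e).
Proof.
move=> ds.
have ds0 : differentiable s 0 by apply/derivable1_diffP; exact: ex_derive.
have dse : differentiable (fun t => s t *: e) 0 by exact: differentiableZl.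
apply: DeriveDef; first exact: diff_derivable.
have dsl : 'd s 0 1 = l by rewrite -deriveE //; exact: derive_val.
by rewrite deriveE // diffZl // dsl.
Qed.

Lemma is_derive_line {R : realType} {n : nat} (x w : 'rV[R]_n) :
  is_derive (0 : R) (1 : R) (fun t => x + t *: w) w.
Proof.
have -> : (fun t : R => x + t *: w) = cst x + (fun t : R => t *: w).
  by apply/funext.
have dw := is_derive_scalel id 1 w (is_derive_id _ _).
have dx : is_derive (0 : R) (1 : R) (cst x) 0 by exact: is_derive_cst.
by have := is_deriveD dx dw; rewrite scale1r add0r.
Qed.

Lemma near_line {R : realType} {n : nat} (x w : 'rV[R]_n)
    (P : 'rV[R]_n -> Prop) :
  (\forall z \near x, P z) -> \forall t \near (0 : R), P (x + t *: w).
Proof.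
move=> Px; apply: (near_curve _ _ P (is_derive_line x w)).
by rewrite scale0r addr0.
Qed.

(** The graph description turned into a defining function: [g] is the last rotated coordinate minus
    [phi] of the other two, and [e] is the vertical direction of the chart. The last clause will
    give [g] a nonzero gradient. *)
Lemma C2a_boundary_chart {R : realType} (a : R) (A : set 'rV[R]_3)
    (x : 'rV[R]_3) :
  C2a_boundary a A -> boundary A x ->
  exists (g : 'rV[R]_3 -> R) (e : 'rV[R]_3),
    [/\ g x = 0, differentiable g x, \forall z \near x, {for z, continuous g},
        \forall z \near x, A z <-> 0 < g z &
        forall z s, g (z + s *: e) = g z + s].
Proof.
move=> bA [clx nix].
have [Q [phi [r [QQ r0 [[phi1 _] _] Aphi]]]] := bA x (conj clx nix).
pose L (z : 'rV[R]_3) : 'rV[R]_2 := col' ord_max (z *m Q).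
have Llin : linear L.
  move=> k u v; rewrite /L mulmxDl -scalemxAl.
  by apply/rowP => i; rewrite !mxE.
pose h (z : 'rV[R]_3) : R^o := (z *m Q) 0 ord_max.
have hlin : linear h by move=> k u v; rewrite /h mulmxDl -scalemxAl !mxE.
have Ldiff z : differentiable L z by exact: linear_rV_differentiable.
have hdiff z : differentiable h z by exact: linear_rV_differentiable.
have gdiff : \forall z \near x, differentiable (fun z => h z - phi (L z)) z.
  have Lball : \forall z \near x, eball (L x) r (L z).
    exact: (differentiable_continuous (Ldiff x)) _ (eball_nbhs (L x) _ r0).
  apply: filterS Lball => z /phi1[phiz _].
  by apply: differentiableB => //; apply: differentiable_comp.
have Ag : \forall z \near x, A z <-> 0 < h z - phi (L z).
  by have := eball_nbhs x _ r0; apply: filterS => z /Aphi; rewrite subr_gt0.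
have gcont : {for x, continuous (fun z => h z - phi (L z))}.
  by apply: differentiable_continuous; exact: nbhs_singleton gdiff.
exists (fun z => h z - phi (L z)), (delta_mx 0 ord_max *m Q^T); split => //.
(* By continuity, [g x < 0] would keep [A] away from [x], and [g x > 0] would put [x] in the
   interior of [A]. *)
- apply/eqP; case: ltgtP => // gx; exfalso.
    have gneg : \forall z \near x, h z - phi (L z) < 0.
      by move/cvgr_lt: gcont; apply.
    have [z [Az [gz Agz]]] := clx _ (filterI gneg Ag).
    by move: (Agz.1 Az); rewrite ltNge ltW.
  apply: nix; have gpos : \forall z \near x, 0 < h z - phi (L z).
    by move/cvgr_gt: gcont; apply.
  by apply: filterS (filterI gpos Ag)  => z [gz Agz]; exact/Agz.
- exact: nbhs_singleton gdiff.
- by apply: filterS gdiff => z; exact: differentiable_continuous.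
- move=> z s.
  have eQ : (delta_mx 0 ord_max *m Q^T) *m Q = delta_mx 0 ord_max :> 'rV[R]_3.
    by rewrite -mulmxA (mulmx1C QQ) mulmx1.
  have -> : L (z + s *: (delta_mx 0 ord_max *m Q^T)) = L z.
    rewrite /L mulmxDl -scalemxAl eQ; apply/rowP => i; rewrite !mxE /=.
    by rewrite [lift _ _ == _]eq_sym (negbTE (neq_lift _ _)) mulr0 addr0.
  by rewrite /h mulmxDl -scalemxAl eQ !mxE !eqxx mulr1; ring.
Qed.

Lemma open_boundaryN {T : topologicalType} (A : set T) (x : T) :
  open A -> boundary A x -> ~ A x.
Proof. by move=> oA [_ nAx] Ax; apply: nAx; exact: open_nbhs_nbhs. Qed.

(** The sign of ['d g x w] decides whether the direction [w] enters [A] or leaves its closure, and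
    the product with the normal is a negative multiple of ['d g x]. *)
Lemma normal_spec {R : realType} (a : R) (A : set 'rV[R]_3) (x : 'rV[R]_3) :
  open A -> C2a_boundary a A -> boundary A x ->
  [/\ enorm (normal A x) = 1,
      forall w, edot (normal A x) w < 0 ->
        \forall t \near (0 : R)^'+, A (x + t *: w) &
      forall w, 0 < edot (normal A x) w ->
        \forall t \near (0 : R)^'+, ~ closure A (x + t *: w)].
Proof.
move=> oA bA bx.
have [g [e [gx dg gc Ag ge]]] := C2a_boundary_chart _ _ _ bA bx.
have dgE w : is_derive (0 : R) (1 : R) (fun t => g (x + t *: w)) ('d g x w).
  have := is_derive_comp_curve g (fun t => x + t *: w) w.
  by rewrite scale0r addr0 => /(_ dg (is_derive_line x w)).
have inA w : 0 < 'd g x w -> \forall t \near (0 : R)^'+, A (x + t *: w).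
  move=> gw; have g0 : g (x + 0 *: w) = 0 by rewrite scale0r addr0.
  have := derive_gt0_near_right _ _ (dgE w) g0 gw.
  move/filterI => /(_ _ (near_right _ _ (near_line x w _ Ag))).
  by apply: filterS => t [gt Agt]; exact/Agt.
have outA w : 'd g x w < 0 ->
    \forall t \near (0 : R)^'+, ~ closure A (x + t *: w).
  move=> gw; have g0 : - g (x + 0 *: w) = 0 by rewrite scale0r addr0 gx oppr0.
  have gw0 : 0 < - 'd g x w by rewrite oppr_gt0.
  have dgN : is_derive (0 : R) (1 : R) (fun t => - g (x + t *: w)) (- 'd g x w).
    exact: (is_deriveN (dgE w)).
  have := derive_gt0_near_right _ _ dgN g0 gw0.
  (* To leave the closure, [g] must be negative around the point and not only at it, so continuity
     of [g] and validity of the chart are needed near each [x + t *: w]. *)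
  have Ag' := near_line x w _ (filterI gc (nbhs_interior Ag)).
  move/filterI => /(_ _ (near_right _ _ (Ag' _))).
  apply: filterS => t [gt [gct Agt]] clt.
  rewrite oppr_gt0 in gt.
  have gneg : \forall z \near x + t *: w, g z < 0 by move/cvgr_lt: gct; apply.
  have [z [Az [gz Agz]]] := clt _ (filterI gneg Agt).
  by move: (Agz.1 Az); rewrite ltNge ltW.
have dge : 'd g x e = 1.
  have := dgE e; rewrite (_ : (fun t => _) = id); last first.
    by apply/funext => t; rewrite ge gx add0r.
  by case=> _ <-; exact: derive_id.
(* Boundary points of the open set [A] are outside [A], so [g <= 0] along the curve, with a maximum
   [0] at [x]. *)
have tangentP v : tangent_vector A x v -> 'd g x v = 0.
  move=> [c [c0 cA dc]].
  have dgc := is_derive_comp_curve g c v; rewrite c0 in dgc.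
  apply: (is_derive_local_max _ _ (dgc dg dc)); first by rewrite /= c0.
  rewrite -c0 in Ag.
  apply: filterS (filterI cA (near_curve _ _ _ dc Ag)) => t [bct Agt] /=.
  by rewrite leNgt; apply/negP => /Agt; exact: open_boundaryN.
have tangent_ex v : tangent_vector A x (v - 'd g x v *: e).
  (* [g] increases at unit speed along [e], so this curve stays in [g = 0]. *)
  have dc : is_derive (0 : R) (1 : R)
      (fun t => x + t *: v + (- g (x + t *: v)) *: e) (v - 'd g x v *: e).
    have dge_v := is_derive_scalel _ _ e (is_deriveN (dgE v)).
    by have := is_deriveD (is_derive_line x v) dge_v; rewrite scaleNr.
  exists (fun t => x + t *: v + (- g (x + t *: v)) *: e); split.
  - by rewrite scale0r addr0 gx oppr0 scale0r addr0.
  - have Ag' := nbhs_interior Ag.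
    have : \forall t \near (0 : R),
        nbhs (x + t *: v + (- g (x + t *: v)) *: e) (fun z => A z <-> 0 < g z).
      apply: (near_curve _ _ (fun y => nbhs y (fun z => A z <-> 0 < g z)) dc).
      by rewrite scale0r addr0 gx oppr0 scale0r addr0.
    apply: filterS => t.
    set z := (_ + _ *: e); have gz : g z = 0 by rewrite /z ge subrr.
    (* As [g z = 0], the point [z] is not in [A]; as [g (z + s *: e) = s], points of [A] lie
       arbitrarily close to [z]. *)
    move=> Az; split; last first.
      move/interior_subset => Az'; have := (nbhs_singleton Az).1 Az'.
      by rewrite gz ltxx.
    move=> B Bz.
    have : \forall s \near (0 : R),
        (B `&` (fun z => A z <-> 0 < g z)) (z + s *: e).
      apply: (near_curve _ _ _ (is_derive_line z e)).
      by rewrite scale0r addr0; exact: filterI.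
    move/near_right/near_right_ex => [s s0 [Bzs Azs]].
    by exists (z + s *: e); split => //; apply/Azs; rewrite ge gz add0r.
  - exact: dc.
(* The gradient of [g] at [x], nonzero because its product with [e] is 1. *)
pose G : 'rV[R]_3 := \row_i 'd g x (delta_mx 0 i).
have GE v : edot G v = 'd g x v.
  rewrite {2}(row_sum_delta v) linear_sum; apply: eq_bigr => i _.
  by rewrite linearZ mxE mulrC.
have G0 : 0 < enorm G.
  apply: enorm_gt0; apply/eqP => G0.
  have := GE e; rewrite G0 dge -(scale0r 0) edotE mul0r => /esym/eqP.
  by rewrite oner_eq0.
(* The normalised negative gradient is a witness, so [xget] does not return its default. The vector
   it picks is identified only through the defining properties: it is orthogonal to each tangent
   vector [v - 'd g x v *: e]. *)
have [N1 Ntan Nout] : is_unit_outward_normal A x (normal A x).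
  apply: (@xgetPex _ 0); exists (- (enorm G)^-1 *: G); split.
  - by rewrite enormZ normrN ger0_norm ?invr_ge0 ?ltW // mulVf ?gt_eqF.
  - by move=> v /tangentP dv; rewrite edotE GE dv mulr0.
  - apply: outA; rewrite linearZ /= -GE -sqr_enorm nmulr_rlt0 ?exprn_gt0 //.
    by rewrite oppr_lt0 invr_gt0.
set k := edot (normal A x) e.
have NE v : edot (normal A x) v = k * 'd g x v.
  have := Ntan _ (tangent_ex v); rewrite !edotE -/k => /subr0_eq ->.
  by rewrite mulrC.
(* From [1 = k * 'd g x N], with [N] the normal: [k = 0] is absurd, and [k > 0] would make [N] point
   into [A]. *)
have k_lt0 : k < 0.
  have := sqr_enorm (normal A x); rewrite N1 expr1n NE => kN.
  rewrite ltNge; apply/negP; rewrite le_eqVlt => /orP[/eqP k0|k_gt0].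
    by move: kN; rewrite -k0 mul0r => /eqP; rewrite oner_eq0.
  have dN : 0 < 'd g x (normal A x) by rewrite -(pmulr_rgt0 _ k_gt0) -kN.
  have [t _ [At ncl]] := near_right_ex _ (filterI (inA _ dN) Nout).
  by apply: ncl; exact: subset_closure.
split; first exact: N1.
- by move=> w Nw; apply: inA; move: Nw; rewrite NE nmulr_rlt0.
- by move=> w Nw; apply: outA; move: Nw; rewrite NE nmulr_rgt0.
Qed.

(** * Shortest paths *)

(** The crossing point is the first exit: [s] is the infimum of the parameters [t >= 0] whose points
    are outside [A]. Openness makes the infimum itself an exit parameter, and all earlier points are
    in [A]. *)
Lemma segment_boundary {R : realType} {n : nat} (A : set 'rV[R]_n)
    (z q : 'rV[R]_n) :
  open A -> A z -> ~ A q ->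
  exists s, [/\ 0 < s, s <= 1 & boundary A (z + s *: (q - z))].
Proof.
move=> oA Az nAq; set w := q - z.
pose T : set R := [set t | 0 <= t /\ ~ A (z + t *: w)].
have T1 : T 1 by split=> //; rewrite scale1r /w addrC subrK.
have T0 : lbound T 0 by move=> t [].
have Tinf : has_inf T by split; [exists 1|exists 0].
have infT t : T t -> inf T <= t by move=> Tt; apply: ge_inf => //; exists 0.
have s_ge0 : 0 <= inf T by apply: lb_le_inf => //; exists 1.
have nAs : ~ A (z + inf T *: w).
  move=> As.
  have /nbhs_ballP[d /= d0 Ad] := near_line _ w A (open_nbhs_nbhs (conj oA As)).
  have [t Tt tlt] := inf_adherent d0 Tinf.
  have [_] := Tt; apply.
  have := Ad (t - inf T); rewrite /ball /= sub0r normrN.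
  have := infT _ Tt => st; rewrite ger0_norm ?subr_ge0 // => /(_ _).
  rewrite -addrA -scalerDl subrKC; apply; lra.
have s_gt0 : 0 < inf T.
  rewrite lt_neqAle s_ge0 andbT; apply/eqP => s0.
  by apply: nAs; rewrite -s0 scale0r addr0.
exists (inf T); split => //; first exact: infT.
split; last by move/interior_subset.
move=> B Bs.
have Bn := near_right _ _ (near_line _ (- w) B Bs).
have [t t0 [Bt ts]] := near_right_ex _ (filterI Bn (nbhs_right_le s_gt0)).
exists (z + inf T *: w + t *: - w); split => //.
apply: contrapT => nA.
have /infT : T (inf T - t).
  split; first by rewrite subr_ge0.
  by rewrite scalerBl addrA -scalerN.
lra.
Qed.

(** * Normals at farthest and nearest boundary points *)

Lemma edot_unit_lt1 {R : realType} {n : nat} (u v : 'rV[R]_n) :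
  enorm u = 1 -> enorm v = 1 -> u != v -> edot u v < 1.
Proof.
move=> u1 v1 uv; have := sqr_enormD u (- v); rewrite enormN edotNr u1 v1 => uv2.
have : 0 < enorm (u - v) ^+ 2 by rewrite exprn_gt0 // enorm_gt0 ?subr_eq0.
by rewrite uv2; lra.
Qed.

Lemma enorm_unit {R : realType} {n : nat} (u : 'rV[R]_n) :
  u != 0 -> enorm ((enorm u)^-1 *: u) = 1.
Proof.
move=> u0; rewrite enormZ ger0_norm ?invr_ge0 ?enorm_ge0 // mulVf //.
by rewrite gt_eqF // enorm_gt0.
Qed.

Lemma scale_unit {R : realType} {n : nat} (u : 'rV[R]_n) :
  u != 0 -> u = enorm u *: ((enorm u)^-1 *: u).
Proof. by move=> u0; rewrite scalerA divff ?scale1r // gt_eqF // enorm_gt0. Qed.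

(** Let [n] be the unit vector along [y - p]. If [N] differs from [n], the direction [n - N] enters
    [A] since [N.n < 1], yet it increases the distance from [p]. *)
Lemma normal_farthest {R : realType} (a : R) (A : set 'rV[R]_3)
    (p y : 'rV[R]_3) :
  open A -> C2a_boundary a A -> boundary A y -> y - p != 0 ->
  (forall z, A z -> enorm (z - p) <= enorm (y - p)) ->
  normal A y = (enorm (y - p))^-1 *: (y - p).
Proof.
move=> oA bA By yp far; have [N1 Nin _] := normal_spec _ _ _ oA bA By.
have n1 := enorm_unit _ yp; have yE := scale_unit _ yp.
set n := (enorm _)^-1 *: _ in n1 yE *; set N := normal A y in N1 Nin *.
apply/eqP; apply: contraT => Nn; clearbody n N.
have Nn1 := edot_unit_lt1 _ _ N1 n1 Nn.
have : edot N (n - N) < 0 by rewrite !edotE -sqr_enorm N1; lra.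
move=> /Nin/near_right_ex[t t0 /far].
rewrite addrAC -ler_sqr ?nnegrE ?enorm_ge0 // sqr_enormD => tle.
have := sqr_ge0 (enorm (t *: (n - N))) => tw.
have : 0 < edot (y - p) (t *: (n - N)).
  rewrite edotZr mulr_gt0 // yE edotZl mulr_gt0 ?enorm_gt0 //.
  by rewrite !edotE -sqr_enorm n1 (edotC n); lra.
by lra.
Qed.

(** Dually, if [N] differs from [n], the direction [N - n] leaves the closure of [A] while it first
    approaches [x]. *)
Lemma normal_nearest {R : realType} (a : R) (A : set 'rV[R]_3)
    (x y : 'rV[R]_3) :
  open A -> C2a_boundary a A -> boundary A y -> y - x != 0 ->
  (forall z, enorm (z - x) < enorm (y - x) -> A z) ->
  normal A y = (enorm (y - x))^-1 *: (y - x).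
Proof.
move=> oA bA By yx near; have [N1 _ Nout] := normal_spec _ _ _ oA bA By.
have n1 := enorm_unit _ yx; have yE := scale_unit _ yx.
have u0 := enorm_gt0 _ yx.
set n := (enorm _)^-1 *: _ in n1 yE *; set N := normal A y in N1 Nout *.
apply/eqP; apply: contraT => Nn; clearbody n N.
have Nn1 := edot_unit_lt1 _ _ N1 n1 Nn.
have : 0 < edot N (N - n) by rewrite !edotE -sqr_enorm N1; lra.
move=> /Nout nA.
have [t t0 [nAt tu]] := near_right_ex _ (filterI nA (nbhs_right_lt u0)).
case: nAt; apply/subset_closure/near.
rewrite addrAC -ltr_sqr ?nnegrE ?enorm_ge0 // sqr_enormD.
rewrite {2}yE edotZl edotZr enormZ exprMn real_normK ?num_real //.
rewrite (sqr_enormD N) enormN !edotE -!sqr_enorm N1 n1 (edotC n).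
(* The squared distance to [x] drops by exactly [2 * t * (r - t) * (1 - d)], positive for
   [0 < t < r]. *)
set r := enorm _ in u0 tu *; set d := edot _ _ in Nn1 *.
have : 0 < t * ((r - t) * (1 - d)) by rewrite !mulr_gt0 // subr_gt0.
by lra.
Qed.

(** * Comparison of a minimizer with other paths *)

Lemma path_length_ge0 {R : realType} (p x y : 'rV[R]_3) :
  0 <= path_length p x y.
Proof. by rewrite addr_ge0 ?enorm_ge0. Qed.

Lemma min_length_le {R : realType} (O D : set 'rV[R]_3) (p x y : 'rV[R]_3) :
  boundary D x -> boundary O y -> min_length O D p <= path_length p x y.
Proof.
move=> Dx Oy; apply: ge_inf; last by exists (x, y).
by exists 0 => _ [xy _ <-]; exact: path_length_ge0.
Qed.

(* The segment from [p] to [z] crosses the boundary of [D]. *)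
Lemma min_length_le_inside {R : realType} (O D : set 'rV[R]_3)
    (p z y : 'rV[R]_3) :
  open D -> ~ D p -> D z -> boundary O y ->
  min_length O D p <= path_length p z y.
Proof.
move=> oD Dp Dz Oy; have [s [s0 s1 Db]] := segment_boundary _ _ _ oD Dz Dp.
apply: le_trans (min_length_le _ _ _ _ _ Db Oy) _; rewrite /path_length.
set b := z + _; have := ler_enorm_dist z b y.
have -> : p - b = (1 - s) *: (p - z).
  by rewrite /b opprD addrA scalerBl scale1r.
have -> : b - z = s *: (p - z) by rewrite /b addrAC subrr add0r.
by rewrite !enormZ !ger0_norm ?subr_ge0 ?(ltW s0) //; lra.
Qed.

Lemma path_length_convex {R : realType} (p x w y : 'rV[R]_3) (t : R) :
  0 <= t -> t <= 1 ->
  path_length p (x + t *: w) y <=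
  (1 - t) * path_length p x y + t * path_length p (x + w) y.
Proof.
move=> t0 t1; rewrite /path_length.
have -> : p - (x + t *: w) = (1 - t) *: (p - x) + t *: (p - (x + w)).
  by apply/rowP => i; rewrite !mxE; ring.
have -> : x + t *: w - y = (1 - t) *: (x - y) + t *: (x + w - y).
  by apply/rowP => i; rewrite !mxE; ring.
have := ler_enormD ((1 - t) *: (p - x)) (t *: (p - (x + w))).
have := ler_enormD ((1 - t) *: (x - y)) (t *: (x + w - y)).
by rewrite !enormZ !ger0_norm ?subr_ge0 // => A B; lra.
Qed.

(** For small [t] the point [x + t *: w] is in [D], where no path beats the minimum; convexity
    carries the inequality from there to [x + w], which may be far from [x]. *)
Lemma minimizer_inward {R : realType} (a : R) (O D : set 'rV[R]_3)
    (p x y w : 'rV[R]_3) :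
  open D -> C2a_boundary a D -> ~ D p -> minimizers O D p (x, y) ->
  edot (normal D x) w < 0 -> path_length p x y <= path_length p (x + w) y.
Proof.
move=> oD bD Dp [/= Dx Oy xyE] Nw.
have [_ Nin _] := normal_spec _ _ _ oD bD Dx.
have t_le1 := nbhs_right_le (@ltr01 R).
have [t t0 [Dt t1]] := near_right_ex _ (filterI (Nin _ Nw) t_le1).
have := min_length_le_inside O D p _ y oD Dp Dt Oy; rewrite -xyE.
move/le_trans => /(_ _ (path_length_convex _ _ _ _ _ (ltW t0) t1)).
by move=> fle; rewrite -(ler_pM2l t0); lra.
Qed.

Lemma path_length_right {R : realType} (p y : 'rV[R]_3) :
  path_length p y y = enorm (p - y).
Proof. by rewrite /path_length subrr enorm0 addr0. Qed.

Lemma path_length_left {R : realType} (p y : 'rV[R]_3) :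
  path_length p p y = enorm (p - y).
Proof. by rewrite /path_length subrr enorm0 add0r. Qed.

Lemma minimizer_straight {R : realType} (a : R) (O D : set 'rV[R]_3)
    (p x y : 'rV[R]_3) :
  open D -> C2a_boundary a D -> ~ D p ->
  (M2plus O D p `|` M2minus O D p `|` Mg O D p) (x, y) ->
  path_length p x y = enorm (p - y).
Proof.
move=> oD bD Dp xyM; apply/le_anti; rewrite ler_enorm_dist andbT.
case: xyM => [[[mxy [_ [_ Nx]]]|[mxy [[_ Nx] _]]]|[mxy [Dx /= Nx]]].
- move: Nx; rewrite oppr_gt0 => /(minimizer_inward _ _ _ _ _ _ _ oD bD Dp mxy).
  by rewrite subrKC path_length_right.
- move: Nx; rewrite oppr_gt0 => /(minimizer_inward _ _ _ _ _ _ _ oD bD Dp mxy).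
  by rewrite subrKC path_length_left.
have [N1 _ _] := normal_spec _ _ _ oD bD Dx.
(* Here [p - x] is only tangent. A correction of length [e / 2] makes it strictly inward and
   lengthens each of the two legs by at most [e / 2]. *)
apply/ler_addgt0Pr => e e0; set N := normal D x in Nx N1.
have : edot N (p - x - (e / 2) *: N) < 0.
  by rewrite edotDr Nx edotNr edotZr -sqr_enorm N1; lra.
move=> /(minimizer_inward _ _ _ _ _ _ _ oD bD Dp mxy) /le_trans; apply.
rewrite addrA subrKC /path_length opprB subrKC addrAC.
have := ler_enormD (p - y) (- ((e / 2) *: N)).
by rewrite !enormN enormZ N1 ger0_norm; lra.
Qed.

(** Otherwise the segment from [x] to [z] would meet the boundary of [O] closer to [x] than [y],
    giving a shorter path through the same [x]. *)
Lemma minimizer_nearest {R : realType} (O D : set 'rV[R]_3)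
    (p x y z : 'rV[R]_3) :
  open O -> O x -> minimizers O D p (x, y) ->
  enorm (z - x) < enorm (y - x) -> O z.
Proof.
move=> oO Ox [/= Dx Oy xyE] zx; apply: contrapT => nOz.
have [s [s0 s1 Ob]] := segment_boundary _ _ _ oO Ox nOz.
have := min_length_le _ _ p _ _ Dx Ob; rewrite -xyE /path_length lerD2l.
rewrite (enorm_distC x y) (enorm_distC x (_ + _)) addrAC subrr add0r.
rewrite enormZ ger0_norm ?(ltW s0) //.
have := enorm_ge0 (z - x) => zx0.
have : s * enorm (z - x) <= enorm (z - x) by rewrite ler_piMl.
lra.
Qed.

Lemma minimizer_Lset {R : realType} (a : R) (O D : set 'rV[R]_3)
    (p x y : 'rV[R]_3) :
  open O -> C2a_boundary a O -> O x -> ~ closure O p ->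
  minimizers O D p (x, y) -> path_length p x y = enorm (p - y) -> Lset O p y.
Proof.
move=> oO bO Ox clp xyM xyp; have [/= Dx Oy _] := xyM.
have yx : y - x != 0.
  rewrite subr_eq0; apply/eqP => yx.
  by apply: (open_boundaryN _ _ oO Oy); rewrite yx.
have yp : y - p != 0.
  by rewrite subr_eq0; apply/eqP => yp; apply: clp; rewrite -yp; case: Oy.
split => //.
have NE := normal_nearest _ _ _ _ oO bO Oy yx
  (fun z => minimizer_nearest _ _ _ _ _ z oO Ox xyM).
(* By [xyp], the triangle inequality for [p], [x], [y] is an equality, so [y - p] and [y - x] have
   the same direction. *)
have col : enorm (y - x) *: (y - p) = enorm (y - p) *: (y - x).
  have := enormD_colinear (x - p) (y - x).
  have -> : x - p + (y - x) = y - p by rewrite addrC subrKA.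
  rewrite (enorm_distC y p) -xyp /path_length (enorm_distC x p).
  rewrite (enorm_distC x y) => /(_ erefl) xpE.
  rewrite -[y - p](subrKA x) scalerDr xpE scalerDl [RHS]addrC.
  by congr (_ + _).
have -> : (enorm (y - p))^-1 *: (y - p) = normal O y.
  rewrite NE; apply: (scalerI (lt0r_neq0 (enorm_gt0 _ yx))).
  rewrite scalerA mulrC -scalerA col !scalerA.
  by rewrite !mulVf ?mulfV ?gt_eqF ?enorm_gt0.
by rewrite -sqr_enorm NE enorm_unit // expr1n.
Qed.

(** * Rays, farthest points and lines *)

Lemma ray_boundary {R : realType} (A : set 'rV[R]_3) (p x : 'rV[R]_3) (M : R) :
  open A -> A x -> x - p != 0 -> (forall z, A z -> enorm (z - p) <= M) ->
  exists s, 0 <= s /\ boundary A (x + s *: (x - p)).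
Proof.
move=> oA Ax xp bd; have xp0 := enorm_gt0 _ xp.
have M0 : 0 <= M by apply: le_trans (bd _ Ax); exact: enorm_ge0.
(* With this [k] the point [x + k *: (x - p)] is at distance [enorm (x - p) + M > M] from [p], hence
   outside [A]. *)
pose k := M / enorm (x - p).
have k0 : 0 <= k by rewrite divr_ge0 ?enorm_ge0.
have nA : ~ A (x + k *: (x - p)).
  move=> /bd; rewrite addrAC -{1}[x - p]scale1r -scalerDl enormZ.
  by rewrite ger0_norm ?addr_ge0 // mulrDl mul1r /k divfK ?gt_eqF //; lra.
have [s [s0 s1 bA]] := segment_boundary _ _ _ oA Ax nA.
exists (s * k); split; first by rewrite mulr_ge0 // ltW.
by move: bA; rewrite addrAC subrr add0r scalerA.
Qed.

Lemma farthest_boundary {R : realType} (A : set 'rV[R]_3) (p y : 'rV[R]_3) :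
  ~ closure A p -> closure A y ->
  (forall z, closure A z -> enorm (z - p) <= enorm (y - p)) -> boundary A y.
Proof.
move=> clp cly far; split => // Ay.
have yp : y - p != 0.
  by rewrite subr_eq0; apply/eqP => yp; apply: clp; rewrite -yp.
have [t t0 At] := near_right_ex _ (near_right _ _ (near_line y (y - p) A Ay)).
have := far _ (subset_closure At).
rewrite addrAC -{1}[y - p]scale1r -scalerDl enormZ.
rewrite ger0_norm ?addr_ge0 ?(ltW t0) //.
by have := mulr_gt0 t0 (enorm_gt0 _ yp); lra.
Qed.

Lemma bounded_closure {R : realType} {n : nat} (A : set 'rV[R]_n) :
  bounded_set A -> bounded_set (closure A).
Proof.
(* [M + 1] bounds [A], as any number above [M] does; the other 1 is the distance from a point of the
   closure to a point of [A]. *)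
move=> [M [Mreal MA]]; exists (M + 2); split; first exact: num_real.
move=> B MB z clz.
have [w [Aw]] := clz _ (nbhsx_ballx z 1 ltr01).
rewrite -ball_normE /= => zw.
rewrite -(subrK w z); apply: le_trans (ler_normD _ _) _.
have wM : `|w| <= M + 1 by apply: MA Aw; rewrite ltrDl.
by apply: le_trans (lerD (ltW zw) wM) _; lra.
Qed.

Lemma exists_farthest {R : realType} (A : set 'rV[R]_3) (p : 'rV[R]_3) :
  A !=set0 -> bounded_set A ->
  exists2 y, closure A y &
    forall z, closure A z -> enorm (z - p) <= enorm (y - p).
Proof.
move=> [x Ax] bA.
have clA0 : closure A !=set0 by exists x; exact: subset_closure.
have clA_compact : compact (closure A).
  apply: bounded_closed_compact; last exact: closed_closure.
  exact: bounded_closure.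
have dist_cont : {within closure A, continuous (fun z => enorm (z - p))}.
  by apply: continuous_subspaceT; exact: enorm_dist_continuous.
have [y] := EVT_max_rV clA0 clA_compact dist_cont.
by rewrite inE => cly far; exists y => // z clz; apply: far; rewrite inE.
Qed.

(** Subtracting two points of [A] close to each other in the direction [v] shows that every [v] is a
    multiple of [u], which fails for two basis vectors. *)
Lemma open_not_in_line {R : realType} (A : set 'rV[R]_3) (p u : 'rV[R]_3) :
  open A -> A !=set0 -> ~ (forall z, A z -> exists k, z - p = k *: u).
Proof.
move=> oA [d Ad] Au.
have col v : exists k, v = k *: u.
  have An := near_line d v A (open_nbhs_nbhs (conj oA Ad)).
  have [t t0 /Au[k1 dt]] := near_right_ex _ (near_right _ _ An).
  have [k0 d0] := Au _ Ad; exists (t^-1 * (k1 - k0)).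
  apply: (scalerI (lt0r_neq0 t0)).
  rewrite scalerA mulrA mulfV ?gt_eqF // mul1r scalerBl -dt -d0.
  by rewrite opprB addrA subrK addrAC subrr add0r.
have [k0 e0] := col (delta_mx 0 0); have [k1 e1] := col (delta_mx 0 1).
move/rowP: e0 => e0; move/rowP: e1 => e1.
have := e0 0; have := e0 1; have := e1 0; have := e1 1; rewrite !mxE /=.
rewrite !mulr1n !mulr0n => k1u1 k1u0 k0u1 k0u0.
have : (1 : R) = 0; last by move/eqP; rewrite oner_eq0.
have -> : (1 : R) = (k0 * u 0 0) * (k1 * u 0 1) by rewrite -k0u0 -k1u1 mulr1.
have -> : k0 * u 0 0 * (k1 * u 0 1) = (k1 * u 0 0) * (k0 * u 0 1) by ring.
by rewrite -k1u0 mul0r.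
Qed.

Theorem proposition6p2 (R : realType) (a0 : R) (Omega D : set 'rV[R]_3)
    (p : 'rV[R]_3)
    (a0_gt0 : 0 < a0) (a0_le1 : a0 <= 1)
    (Omega_neq0 : Omega !=set0) (Omega_open : open Omega)
    (Omega_connected : connected Omega) (Omega_bounded : bounded_set Omega)
    (Omega_C2a : C2a_boundary a0 Omega)
    (D_open : open D) (D_C2a : C2a_boundary a0 D)
    (D_sub : closure D `<=` Omega)
    (OmegaD_connected : connected (Omega `\` closure D))
    (p_out : ~ closure Omega p)
    (L_single : exists y0, Lset Omega p = [set y0]) :
  M2plus Omega D p `|` M2minus Omega D p `|` Mg Omega D p = set0.
Proof.
have [y0 LE] := L_single.
have Dp : ~ D p by move=> /subset_closure/D_sub/subset_closure.
rewrite -subset0 => -[x y] xyM.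
have xyp := minimizer_straight _ _ _ _ _ _ D_open D_C2a Dp xyM.
have xymin : minimizers Omega D p (x, y) by case: xyM => [[]|] [].
have [/= Dx Oy xyE] := xymin.
have Ox : Omega x by apply: D_sub; case: Dx.
have yy0 : y = y0.
  have := minimizer_Lset _ _ _ _ _ _ Omega_open Omega_C2a Ox p_out xymin xyp.
  by rewrite LE.
(* A farthest point of the closure is a boundary point whose normal is radial, so it is in [Lset]
   and equals [y]. *)
have farL z : closure Omega z ->
    (forall z', closure Omega z' -> enorm (z' - p) <= enorm (z - p)) -> z = y.
  move=> clz far; have bz := farthest_boundary _ _ _ p_out clz far.
  have zp : z - p != 0.
    by rewrite subr_eq0; apply/eqP => zp; apply: p_out; rewrite -zp.
  have NE := normal_farthest _ _ _ _ Omega_open Omega_C2a bz zp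
    (fun z' Oz => far z' (subset_closure Oz)).
  suff : Lset Omega p z by rewrite LE yy0.
  by split => //; rewrite NE -sqr_enorm enorm_unit // expr1n.
have [ym clym far] := exists_farthest Omega p Omega_neq0 Omega_bounded.
have ymE := farL _ clym far; rewrite {}ymE in clym far.
have Dline z : boundary D z -> exists k, z - p = k *: (y - p).
  move=> Dz; have Oz : Omega z by apply: D_sub; case: Dz.
  have zp : z - p != 0.
    rewrite subr_eq0; apply/eqP => zp; apply: p_out.
    by rewrite -zp; exact: subset_closure.
  have [s [s0 bb]] := ray_boundary _ _ _ _ Omega_open Oz zp
    (fun z' Oz' => far z' (subset_closure Oz')).
  set b := z + _ in bb.
  have bp : b - p = (1 + s) *: (z - p) by rewrite /b addrAC scalerDl scale1r.
  (* The path from [p] through [z] to [b] is straight, so [enorm (b - p)] is at least the minimal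
     length [enorm (p - y)]. Thus [b] is a farthest point too. *)
  have be : b = y.
    apply: farL; first by case: bb.
    move=> z' /far /le_trans; apply.
    rewrite enorm_distC -xyp xyE.
    apply: le_trans (min_length_le _ _ p _ _ Dz bb) _.
    rewrite /path_length (enorm_distC p z) (enorm_distC z b) bp.
    have -> : b - z = s *: (z - p) by rewrite /b addrAC subrr add0r.
    by rewrite !enormZ !ger0_norm ?addr_ge0 // mulrDl mul1r.
  exists (1 + s)^-1; rewrite -be bp scalerA mulVf ?scale1r //.
  by rewrite gt_eqF // ltr_wpDr.
have D0 : D !=set0.
  by case: Dx => /(_ setT filterT)[d [Dd _]] _; exists d.
apply: (open_not_in_line D p (y - p) D_open D0) => d Dd.
(* The segment from [d] to [p] meets the boundary of [D] at a point already known to be on the line.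
   That point is not [p], which is outside [Omega], so [1 - s] is invertible and [d] is on the line
   as well. *)
have [s [s0 s1 bs]] := segment_boundary _ _ _ D_open Dd Dp.
have [k] := Dline _ bs.
have -> : d + s *: (p - d) - p = (1 - s) *: (d - p).
  by apply/rowP => i; rewrite !mxE; ring.
have s1n : 1 - s != 0.
  rewrite subr_eq0; apply/eqP => s1E; apply: p_out; apply: subset_closure.
  by apply: D_sub; move: bs; rewrite -s1E scale1r subrKC; case.
move=> kE; exists ((1 - s)^-1 * k).
by rewrite -scalerA -kE scalerA mulVf // scale1r.
Qed.
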